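(* Let $\mathcal{H}$ be a real Hilbert space, let $A,B\subseteq\mathcal{H}$ be nonempty closed convex sets, and let $T_{A,B}:\mathcal{H}\to\mathcal{H}$ be their 2-set-Douglas-Rachford operator. Then: (i) if $T_{A,B}$ has a fixed point, $T_{A,B}$ is strongly quasi-nonexpansive; (ii) $T_{A,B}$ is strongly nonexpansive.
   Context: For a nonempty closed convex set $A\subseteq\mathcal{H}$, $P_A$ is the orthogonal (nearest point, metric) projection onto $A$ and $R_A:=2P_A-\mathrm{Id}$ is the reflection operator into $A$, where $\mathrm{Id}$ is the identity. The 2-set-Douglas-Rachford operator is $T_{A,B}:=\frac12(\mathrm{Id}+R_BR_A)$. Let $T:\mathcal{H}\to\mathcal{H}$ and $\operatorname{Fix}T:=\{x: T(x)=x\}$. An operator $T$ having a fixed point is strongly quasi-nonexpansive if there is $\alpha>0$ such that $\|T(x)-z\|^2\leq\|x-z\|^2-\alpha\|T(x)-x\|^2$ for all $x\in\mathcal{H}$ and all $z\in\operatorname{Fix}T$. An operator $T$ is strongly nonexpansive if it is nonexpansive (i.e. $\|T(x)-T(y)\|\leq\|x-y\|$ for all $x,y$) and for all sequences $\{x^k\}_{k=0}^\infty,\{y^k\}_{k=0}^\infty\subseteq\mathcal{H}$ such that $(x^k-y^k)$ is bounded and $\|x^k-y^k\|-\|T(x^k)-T(y^k)\|\to0$, it follows that $(x^k-y^k)-(T(x^k)-T(y^k))\to0$. *)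

(* Defs.v *)
From mathcomp Require Import all_boot all_order all_algebra.
From mathcomp Require Import all_classical all_reals all_analysis.

Set Implicit Arguments.
Unset Strict Implicit.
Unset Printing Implicit Defensive.

Import Order.TTheory GRing.Theory Num.Theory.
Import numFieldNormedType.Exports.

Local Open Scope classical_set_scope.
Local Open Scope ring_scope.

(* A real Hilbert space is a complete normed module over a [realType] whose
   norm is induced by an inner product: [ip] is bilinear, symmetric and positive
   definite by its type [{dot H for idfun}]. *)
Definition is_inner_product (R : realType) (H : completeNormedModType R)
  (ip : {dot H for idfun}) : Prop := forall x : H, ip x x = `|x| ^+ 2.

Definition nearest_points (R : realType) (H : normedModType R) (A : set H)
  (x : H) : set H := [set p | A p /\ forall a, A a -> `|x - p| <= `|x - a|].

(* The unique nearest point when [A] is nonempty, closed and convex and the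
   ambient space is Hilbert; the value 0 is taken only when there is no
   nearest point. *)
Definition proj (R : realType) (H : normedModType R) (A : set H) (x : H) : H :=
  xget 0 (nearest_points A x).

Definition reflection (R : realType) (H : normedModType R) (A : set H)
  (x : H) : H := 2 *: proj A x - x.

Definition douglas_rachford (R : realType) (H : normedModType R) (A B : set H)
  (x : H) : H := 2^-1 *: (x + reflection B (reflection A x)).

Definition Fix (T : Type) (f : T -> T) : set T := [set x | f x = x].

Definition strongly_quasi_nonexpansive (R : realType) (H : normedModType R)
  (T : H -> H) : Prop :=
  Fix T !=set0 /\
  exists2 alpha : R, 0 < alpha & forall x z : H, Fix T z ->
    `|T x - z| ^+ 2 <= `|x - z| ^+ 2 - alpha * `|T x - x| ^+ 2.

Definition nonexpansive (R : realType) (H : normedModType R)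
  (T : H -> H) : Prop := forall x y : H, `|T x - T y| <= `|x - y|.

Definition strongly_nonexpansive (R : realType) (H : normedModType R)
  (T : H -> H) : Prop :=
  nonexpansive T /\
  forall x y : nat -> H,
    bounded_fun (fun k => x k - y k) ->
    (fun k => `|x k - y k| - `|T (x k) - T (y k)|) @ \oo --> (0 : R) ->
    (fun k => (x k - y k) - (T (x k) - T (y k))) @ \oo --> (0 : H).

(* Main.v *)
(** A reflection 2 P_A - Id is nonexpansive because P_A is 1-cocoercive, so the
    parallelogram identity makes the average T of Id and R_B R_A firmly
    nonexpansive: |Tx - Ty|^2 + |(x - y) - (Tx - Ty)|^2 <= |x - y|^2.  Taking y
    fixed gives (i) with alpha = 1.  For (ii), the squared gap is at most
    (|x - y| - |Tx - Ty|) (|x - y| + |Tx - Ty|), whose second factor is bounded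
    along the sequences. *)
Require Import Defs.
From mathcomp Require Import all_boot all_order all_algebra.
From mathcomp Require Import all_classical all_reals all_analysis.
From mathcomp Require Import ring lra.
Import Order.TTheory GRing.Theory Num.Theory.
Import numFieldNormedType.Exports.
Local Open Scope classical_set_scope.
Local Open Scope ring_scope.

(** This form uses norms only, so both conclusions are drawn from it in an arbitrary normed module;
    the inner product serves only to establish it. *)
Definition firmly_nonexpansive {R : realType} {H : normedModType R}
    (T : H -> H) : Prop :=
  forall x y : H,
    `|T x - T y| ^+ 2 + `|(x - y) - (T x - T y)| ^+ 2 <= `|x - y| ^+ 2.

Section InnerProduct.
Context {R : realType} {H : completeNormedModType R} {ip : {dot H for idfun}}.
Hypothesis hip : is_inner_product ip.

Lemma ipC (u v : H) : ip u v = ip v u.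
Proof. by rewrite (hermC ip) /= expr0 mul1r. Qed.

Lemma ipDl (u v w : H) : ip (u + v) w = ip u w + ip v w.
Proof. exact: linearDl. Qed.

Lemma ipBl (u v w : H) : ip (u - v) w = ip u w - ip v w.
Proof. exact: linearBl. Qed.

Lemma ipBr (u v w : H) : ip w (u - v) = ip w u - ip w v.
Proof. exact: linearBr. Qed.

Lemma ipZl (t : R) (u v : H) : ip (t *: u) v = t * ip u v.
Proof. exact: linearZl_LR. Qed.

Lemma sqnormD (u v : H) : `|u + v| ^+ 2 = `|u| ^+ 2 + 2 * ip u v + `|v| ^+ 2.
Proof.
rewrite -!hip ipDl !(ipC _ (u + v)) !ipDl (ipC v u); ring.
Qed.

Lemma sqnormB (u v : H) : `|u - v| ^+ 2 = `|u| ^+ 2 - 2 * ip u v + `|v| ^+ 2.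
Proof. rewrite -!hip !(ipBl, ipBr) (ipC v u); ring. Qed.

Lemma sqnormZ (t : R) (u : H) : `|t *: u| ^+ 2 = t ^+ 2 * `|u| ^+ 2.
Proof. by rewrite normrZ exprMn real_normK ?num_real. Qed.

Lemma parallelogram (u v : H) :
  `|u + v| ^+ 2 + `|u - v| ^+ 2 = 2 * (`|u| ^+ 2 + `|v| ^+ 2).
Proof. rewrite sqnormB sqnormD; ring. Qed.

End InnerProduct.

Section Projection.
Context {R : realType} {H : completeNormedModType R} {ip : {dot H for idfun}}.
Hypothesis hip : is_inner_product ip.
Variable A : set H.
Hypotheses (A0 : A !=set0) (Acl : closed A) (Acv : convex_set A).

Lemma convex_set_line (a b : H) (t : R) : 0 <= t <= 1 ->
  A a -> A b -> A (t *: a + (1 - t) *: b).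
Proof.
move=> /andP[t0 t1] Aa Ab.
exact: set_mem (Acv a b (Itv01 t0 t1) (mem_set Aa) (mem_set Ab)).
Qed.

(** A minimizing sequence for the squared distance is Cauchy; completeness gives it a limit, which
    lies in [A] by closedness and attains the infimum. *)
Lemma nearest_points_neq0 (x : H) : nearest_points A x !=set0.
Proof.
pose E := [set `|x - a| ^+ 2 | a in A].
have hE : has_inf E.
  split; first by case: A0 => a Aa; exists (`|x - a| ^+ 2), a.
  by exists 0 => _ [a _ <-]; rewrite sqr_ge0.
pose d := inf E.
have dle a : A a -> d <= `|x - a| ^+ 2.
  by move=> Aa; apply: ge_inf; [exact: hE.2 | exists a].
have /choice[a aP] : forall n, exists a, A a /\ `|x - a| ^+ 2 < d + harmonic n.
  move=> n; have h : 0 < harmonic n :> R by rewrite invr_gt0 ltr0n.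
  by have [_ [a Aa <-] ad] := inf_adherent h hE; exists a.
(* Parallelogram identity for [x - a n] and [x - a m]: by convexity the midpoint of [a n] and [a m]
   lies in [A], so its squared distance to [x] is at least [d], and the terms in [d] cancel. *)
have close n m : `|a n - a m| ^+ 2 <= 2 * harmonic n + 2 * harmonic m.
  have [An dn] := aP n; have [Am dm] := aP m.
  have := parallelogram hip (x - a n) (x - a m).
  have -> : x - a n - (x - a m) = - (a n - a m).
    by rewrite !opprB addrC addrA subrK.
  rewrite normrN.
  have -> : x - a n + (x - a m) = 2 *: (x - (2^-1 *: a n + (1 - 2^-1) *: a m)).
    rewrite scalerBr scalerDr !scalerA mulfV// scale1r.
    rewrite (_ : 2 * (1 - 2^-1) = 1 :> R); last by field.
    by rewrite scale1r scaler_nat mulr2n opprD addrACA.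
  rewrite sqnormZ.
  have := dle _ (convex_set_line (a n) (a m) 2^-1 ltac:(lra) An Am).
  move: dn dm; lra.
have cva : cvg (a @ \oo).
  apply: cauchy_cvg; apply: cauchy_exP => e e0.
  (* Two harmonic terms, each with factor 2 in [close], then add up to less than [e ^+ 2]. *)
  have e4 : 0 < e ^+ 2 / 4 by rewrite divr_gt0 ?exprn_gt0.
  have [N _ hN] := cvgr0_norm_lt _ (@cvg_harmonic R) _ e4.
  exists (a N), N => // n Nn; rewrite -ball_normE /=.
  have hN1 := ler_normlW (ltW (hN N (leqnn N))).
  have hn1 := le_lt_trans (ler_norm _) (hN n Nn).
  rewrite -(ltr_pXn2r (n := 2)) ?nnegrE ?(ltW e0)//.
  apply: le_lt_trans (close N n) _.
  by set u := harmonic N in hN1 *; set v := harmonic n in hn1 *; lra.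
exists (lim (a @ \oo)); split.
  by apply: (closed_cvg _ Acl _ _ cva); apply: nearW => n; case: (aP n).
move=> b /dle Hb; rewrite -(ler_pXn2r (n := 2)) ?nnegrE//.
apply: le_trans Hb.
have c1 : `|x - a n| ^+ 2 @[n --> \oo] --> `|x - lim (a @ \oo)| ^+ 2.
  apply: cvgM; apply: cvg_norm; apply: cvgB => //; exact: cvg_cst.
have c2 : d + harmonic n @[n --> \oo] --> d + (0 : R).
  by apply: cvgD; [exact: cvg_cst | exact: cvg_harmonic].
rewrite -[leRHS]addr0.
by apply: (ler_cvg_to c1 c2); apply: nearW => n; apply: ltW; case: (aP n).
Qed.

(** Existence of a nearest point rules out the default value 0 of [xget]. *)
Lemma proj_nearest (x : H) : nearest_points A x (Defs.proj A x).
Proof. exact: xgetPex _ (nearest_points_neq0 x). Qed.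

(** If the inner product [c] were positive, a small move from the projection towards [a] would stay
    in [A] and come strictly closer to [x]. *)
Lemma proj_variational (x a : H) : A a ->
  ip (x - Defs.proj A x) (a - Defs.proj A x) <= 0.
Proof.
move=> Aa; have [Ap pmin] := proj_nearest x.
set p := Defs.proj A x in Ap pmin *.
set c := ip _ _; rewrite leNgt; apply/negP => c0.
pose q := `|a - p| ^+ 2; have q0 : 0 <= q by rewrite sqr_ge0.
have cq : 0 < c + q by lra.
(* The move by [t] changes the squared distance by [t ^+ 2 * q - 2 * t * c]. Since
   [t * q = c - t * c], this equals [- t * c * (1 + t)], which is negative. The choice also covers
   [q = 0]. *)
pose t := c / (c + q).
have t0 : 0 < t by rewrite divr_gt0.
have t1 : t <= 1 by rewrite ler_pdivrMr// mul1r; lra.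
have tcq : t * (c + q) = c by rewrite /t divfK// gt_eqF.
have := pmin _ (convex_set_line a p t ltac:(lra) Aa Ap).
rewrite -(ler_pXn2r (n := 2)) ?nnegrE//.
have -> : x - (t *: a + (1 - t) *: p) = (x - p) - t *: (a - p).
  by rewrite scalerBl scale1r scalerBr addrCA opprD addrA.
rewrite (sqnormB hip (x - p)) sqnormZ ipC ipZl ipC -/c -/q.
nra.
Qed.

(** Sum of two variational inequalities: the one at [x] tested with the projection of [y], and the
    one with the roles exchanged. *)
Lemma proj_cocoercive (x y : H) :
  `|Defs.proj A x - Defs.proj A y| ^+ 2 <=
  ip (x - y) (Defs.proj A x - Defs.proj A y).
Proof.
have := proj_variational x _ (proj_nearest y).1.
have := proj_variational y _ (proj_nearest x).1.
rewrite -hip !(ipBl, ipBr).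
rewrite !(ipC (Defs.proj A y) (Defs.proj A x)); lra.
Qed.

Lemma reflection_nonexpansive : nonexpansive (reflection A).
Proof.
move=> x y; rewrite -(ler_pXn2r (n := 2)) ?nnegrE//.
have -> : reflection A x - reflection A y =
    2 *: (Defs.proj A x - Defs.proj A y) - (x - y).
  by rewrite /reflection scalerBr !opprD !opprK addrACA.
(* With [u] the difference of the projections, the square expands to
   [|x - y|^2 + 4 (|u|^2 - ip (x - y) u)], whose bracket is nonpositive by cocoercivity. *)
rewrite (sqnormB hip) sqnormZ ipZl (ipC _ (x - y)).
have := proj_cocoercive x y; lra.
Qed.

End Projection.

Lemma douglas_rachford_firmly_nonexpansive {R : realType}
  {H : completeNormedModType R} {ip : {dot H for idfun}}
  (hip : is_inner_product ip) (A B : set H) :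
  A !=set0 -> closed A -> convex_set A ->
  B !=set0 -> closed B -> convex_set B ->
  firmly_nonexpansive (douglas_rachford A B).
Proof.
set T := douglas_rachford A B.
move=> A0 Acl Acv B0 Bcl Bcv x y.
pose RR z := reflection B (reflection A z).
have RRne : `|RR x - RR y| <= `|x - y|.
  apply: le_trans (reflection_nonexpansive hip A A0 Acl Acv x y).
  exact: reflection_nonexpansive hip B B0 Bcl Bcv _ _.
have TE : T x - T y = 2^-1 *: ((x - y) + (RR x - RR y)).
  by rewrite /T /douglas_rachford -scalerBr opprD addrACA.
have -> : (x - y) - (T x - T y) = 2^-1 *: ((x - y) - (RR x - RR y)).
  have {1}-> : x - y = 2^-1 *: ((x - y) + (x - y)).
    by rewrite -[in RHS]mulr2n -(scaler_nat 2 (x - y)) scalerK.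
  by rewrite TE -scalerBr opprD addrA addrK.
rewrite TE !sqnormZ -mulrDr (parallelogram hip).
move: RRne; rewrite -(ler_pXn2r (n := 2)) ?nnegrE//; lra.
Qed.

Lemma firmly_nonexpansive_strongly_quasi_nonexpansive
    {R : realType} {H : normedModType R} (T : H -> H) :
  firmly_nonexpansive T ->
  Fix T !=set0 -> strongly_quasi_nonexpansive T.
Proof.
move=> fT Fix0; split=> //; exists 1 => // x z Tz.
have := fT x z; rewrite Tz mul1r.
have -> : x - z - (T x - z) = - (T x - x).
  by rewrite !opprB addrA subrK.
rewrite normrN; lra.
Qed.

Lemma firmly_nonexpansive_strongly_nonexpansive
    {R : realType} {H : normedModType R} (T : H -> H) :
  firmly_nonexpansive T ->
  strongly_nonexpansive T.
Proof.
move=> fT.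
have Tne : nonexpansive T.
  move=> x y; rewrite -(ler_pXn2r (n := 2)) ?nnegrE//.
  by apply: le_trans (fT x y); rewrite lerDl sqr_ge0.
split=> // x y xy_bdd gap0.
have [M M0 bd] := pinfty_ex_gt0 xy_bdd.
have {}bd n : `|x n - y n| <= M by exact: bd.
apply/cvgr0Pnorm_lt => e e0.
(* With [v <= u <= M] for the two norms, the squared gap is at most [(u - v) * (u + v) <= (u - v) *
   (2 * M + 1)], so this bound on [u - v] keeps it below [e ^+ 2]. *)
have dlt : 0 < e ^+ 2 / (2 * M + 1) by rewrite divr_gt0 ?exprn_gt0//; lra.
apply: filterS (cvgr0_norm_lt _ gap0 _ dlt) => n /(le_lt_trans (ler_norm _)).
rewrite ltr_pdivlMr; last lra.
move=> small; rewrite -(ltr_pXn2r (n := 2)) ?nnegrE ?(ltW e0)//.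
have := fT (x n) (y n); have := Tne (x n) (y n); have := bd n.
move: small.
set u := `|x n - y n|; set v := `|T (x n) - T (y n)|.
have : 0 <= v := normr_ge0 _.
set w := `|_| ^+ 2; nra.
Qed.

Theorem lemma17 (R : realType) (H : completeNormedModType R)
  (ip : {dot H for idfun}) (hip : is_inner_product ip)
  (A B : set H)
  (A0 : A !=set0) (Acl : closed A) (Acv : convex_set A)
  (B0 : B !=set0) (Bcl : closed B) (Bcv : convex_set B) :
  (Fix (douglas_rachford A B) !=set0 ->
     strongly_quasi_nonexpansive (douglas_rachford A B)) /\
  strongly_nonexpansive (douglas_rachford A B).
Proof.
have fT := douglas_rachford_firmly_nonexpansive hip A B A0 Acl Acv B0 Bcl Bcv.
split; first exact: firmly_nonexpansive_strongly_quasi_nonexpansive.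
exact: firmly_nonexpansive_strongly_nonexpansive.
Qed.
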